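(* Let $p \geqslant 5$ be a prime and let $G$ be a finite powerful $p$-group. Then $\nu(G)$ is a potent $p$-group. In particular, $\exp(\nu(G))=\exp(G)$.
   Context: Notation: $x^y = y^{-1}xy$ and $[x,y]$ is the group commutator. For a group $G$, let $\varphi: G \to G^{\varphi}$, $g \mapsto g^{\varphi}$, be an isomorphism onto a copy $G^{\varphi}$ of $G$. Define $$\nu(G) = \langle G \cup G^{\varphi} \mid [g_1,g_2^{\varphi}]^{g_3} = [g_1^{g_3},(g_2^{g_3})^{\varphi}] = [g_1,g_2^{\varphi}]^{g_3^{\varphi}},\ g_1,g_2,g_3 \in G\rangle,$$ where the relations of $G$ and of $G^{\varphi}$ are also understood to hold (so $\nu(G)$ is a quotient of the free product $G * G^{\varphi}$). For a $p$-group $H$ and an integer $m\ge 1$, $H^{m}$ denotes the subgroup generated by all $h^m$, $h \in H$; $H'=[H,H]$; $\gamma_1(H)=H$ and $\gamma_{k+1}(H)=[\gamma_k(H),H]$. The exponent of $H$ is denoted $\exp(H)$. For an odd prime $p$, a finite $p$-group $H$ is powerful if $H'\leqslant H^p$, and potent if $\gamma_{p-1}(H)\leqslant H^p$. *)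

(* Defs.v *)
From HB Require Import structures.
From mathcomp Require Import all_boot all_fingroup all_solvable.
From mathcomp Require Import boolp generic_quotient.

Set Implicit Arguments.
Unset Strict Implicit.
Unset Printing Implicit Defensive.

Local Open Scope group_scope.
Local Open Scope quotient_scope.

(* nu(G) is not known to be finite a priori, so it is built as a groupType,    *)
(* for an arbitrary groupType G, as the set of words over the disjoint union   *)
(* G + G modulo the congruence generated by the relations: inl g is the        *)
(* generator g and inr g is the generator g^phi. The universal property below  *)
(* (nu_liftP, nu_lift_uniq) shows that this is the group so presented.         *)

Section Words.
Variable G : groupType.
Implicit Types (x y : G + G) (u v w : seq (G + G)) (g : G).

Definition linv x : G + G :=
  match x with inl g => inl g^-1 | inr g => inr g^-1 end.

Definition winv w := rev (map linv w).

Definition wconj u v := winv v ++ u ++ v.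

Definition wcomm u v := winv u ++ winv v ++ u ++ v.

Inductive nu_rel : seq (G + G) -> seq (G + G) -> Prop :=
| NuMulL g1 g2 : nu_rel [:: inl g1; inl g2] [:: inl (g1 * g2)]
| NuMulR g1 g2 : nu_rel [:: inr g1; inr g2] [:: inr (g1 * g2)]
| NuOneL : nu_rel [:: inl 1] [::]
| NuOneR : nu_rel [:: inr 1] [::]
| NuConjL g1 g2 g3 :
    nu_rel (wconj (wcomm [:: inl g1] [:: inr g2]) [:: inl g3])
           (wcomm [:: inl (g1 ^ g3)] [:: inr (g2 ^ g3)])
| NuConjR g1 g2 g3 :
    nu_rel (wcomm [:: inl (g1 ^ g3)] [:: inr (g2 ^ g3)])
           (wconj (wcomm [:: inl g1] [:: inr g2]) [:: inr g3])
| NuRefl u : nu_rel u u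
| NuSym u v : nu_rel u v -> nu_rel v u
| NuTrans u v w : nu_rel u v -> nu_rel v w -> nu_rel u w
| NuCat u u' v v' : nu_rel u u' -> nu_rel v v' -> nu_rel (u ++ v) (u' ++ v').

Lemma linvK : involutive linv.
Proof. by case=> g /=; rewrite invgK. Qed.

Lemma winvK : involutive winv.
Proof. by move=> w; rewrite /winv map_rev revK mapK //; apply: linvK. Qed.

Lemma nu_rel_winvl w : nu_rel (winv w ++ w) [::].
Proof.
elim: w => [|x w IHw]; first exact: NuRefl.
rewrite /winv /= rev_cons -cats1 -catA -/(winv w).
apply: NuTrans IHw; apply: NuCat; first exact: NuRefl.
apply: (@NuCat [:: linv x; x] [::] w w); last exact: NuRefl.
case: x => g /=.
  by apply: NuTrans (NuMulL _ _) _; rewrite mulVg; apply: NuOneL.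
by apply: NuTrans (NuMulR _ _) _; rewrite mulVg; apply: NuOneR.
Qed.

Lemma nu_rel_winvr w : nu_rel (w ++ winv w) [::].
Proof. by have:= nu_rel_winvl (winv w); rewrite winvK. Qed.

Lemma nu_rel_winv u v : nu_rel u v -> nu_rel (winv u) (winv v).
Proof.
move=> uv; apply: (@NuTrans _ (winv u ++ (v ++ winv v))).
  rewrite -[X in nu_rel X _]cats0.
  by apply: NuCat; [apply: NuRefl | apply: NuSym; apply: nu_rel_winvr].
rewrite catA -[X in nu_rel _ X]cat0s.
apply: NuCat; last exact: NuRefl.
apply: NuTrans (nu_rel_winvl u).
by apply: NuCat; [apply: NuRefl | apply: NuSym].
Qed.

Definition nu_relb : rel (seq (G + G)) := fun u v => `[< nu_rel u v >].

Lemma nu_relb_refl : reflexive nu_relb.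
Proof. by move=> u; apply/asboolP; apply: NuRefl. Qed.

Lemma nu_relb_sym : symmetric nu_relb.
Proof. by move=> u v; apply/asboolP/asboolP; apply: NuSym. Qed.

Lemma nu_relb_trans : transitive nu_relb.
Proof.
by move=> v u w /asboolP uv /asboolP vw; apply/asboolP; apply: NuTrans vw.
Qed.

Canonical nu_equiv := EquivRel nu_relb nu_relb_refl nu_relb_sym nu_relb_trans.

End Words.

Definition nu (G : groupType) : Type := {eq_quot (nu_equiv G)}.

Section NuGroup.
Variable G : groupType.


Lemma nu_piP (u v : seq (G + G)) :
  (\pi_(nu G) u = \pi_(nu G) v) <-> nu_rel u v.
Proof.
split=> [/eqmodP/asboolP // | uv]; apply/eqmodP; exact/asboolP.
Qed.

Lemma nu_reprP (u : seq (G + G)) : nu_rel (repr (\pi_(nu G) u)) u.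
Proof. by apply/nu_piP; rewrite reprK. Qed.

Lemma nu_pi_surj (a : nu G) : exists u, a = \pi_(nu G) u.
Proof. by exists (repr a); rewrite reprK. Qed.

Definition nu_mul (a b : nu G) : nu G := \pi_(nu G) (repr a ++ repr b).
Definition nu_one : nu G := \pi_(nu G) [::].
Definition nu_inv (a : nu G) : nu G := \pi_(nu G) (winv (repr a)).

Lemma nu_mul_pi u v : nu_mul (\pi_(nu G) u) (\pi_(nu G) v) = \pi_(nu G) (u ++ v).
Proof. by apply/nu_piP; apply: NuCat; apply: nu_reprP. Qed.

Lemma nu_inv_pi u : nu_inv (\pi_(nu G) u) = \pi_(nu G) (winv u).
Proof. by apply/nu_piP; apply: nu_rel_winv; apply: nu_reprP. Qed.

Lemma nu_mulA : associative nu_mul.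
Proof.
move=> a b c; have [u ->] := nu_pi_surj a; have [v ->] := nu_pi_surj b.
have [w ->] := nu_pi_surj c.
by rewrite !nu_mul_pi catA.
Qed.

Lemma nu_mul1 : left_id nu_one nu_mul.
Proof. by move=> a; have [u ->] := nu_pi_surj a; rewrite nu_mul_pi. Qed.

Lemma nu_mulr1 : right_id nu_one nu_mul.
Proof. by move=> a; have [u ->] := nu_pi_surj a; rewrite nu_mul_pi cats0. Qed.

Lemma nu_mulV : left_inverse nu_one nu_inv nu_mul.
Proof.
move=> a; have [u ->] := nu_pi_surj a; rewrite nu_inv_pi nu_mul_pi.
by apply/nu_piP; apply: nu_rel_winvl.
Qed.

Lemma nu_mulrV : right_inverse nu_one nu_inv nu_mul.
Proof.
move=> a; have [u ->] := nu_pi_surj a; rewrite nu_inv_pi nu_mul_pi.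
by apply/nu_piP; apply: nu_rel_winvr.
Qed.

HB.instance Definition _ := Choice.on (nu G).
HB.instance Definition _ :=
  isGroup.Build (nu G) nu_mulA nu_mul1 nu_mulr1 nu_mulV nu_mulrV.

Definition nu_l (g : G) : nu G := \pi_(nu G) [:: inl g].
Definition nu_r (g : G) : nu G := \pi_(nu G) [:: inr g].

Lemma nu_lM : {morph nu_l : g h / g * h}.
Proof.
move=> g h; apply: etrans (esym (nu_mul_pi _ _)).
by apply/nu_piP; apply: NuSym; apply: NuMulL.
Qed.

Lemma nu_rM : {morph nu_r : g h / g * h}.
Proof.
move=> g h; apply: etrans (esym (nu_mul_pi _ _)).
by apply/nu_piP; apply: NuSym; apply: NuMulR.
Qed.

End NuGroup.

Section NuUniversal.
Variables G H : groupType.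

Definition nu_compatible (f h : G -> H) :=
  forall g1 g2 g3 : G,
    [~ f g1, h g2] ^ f g3 = [~ f (g1 ^ g3), h (g2 ^ g3)] /\
    [~ f (g1 ^ g3), h (g2 ^ g3)] = [~ f g1, h g2] ^ h g3.

Definition weval (f h : G -> H) (w : seq (G + G)) : H :=
  \prod_(x <- w) (match x with inl g => f g | inr g => h g end).

Definition nu_lift (f h : G -> H) (a : nu G) : H := weval f h (repr a).

Variables f h : G -> H.
Hypotheses (fM : {morph f : x y / x * y}) (hM : {morph h : x y / x * y}).

Let f1 : f 1 = 1.
Proof. by apply: (mulgI (f 1)); rewrite -fM !mulg1. Qed.
Let h1 : h 1 = 1.
Proof. by apply: (mulgI (h 1)); rewrite -hM !mulg1. Qed.
Let fV g : f g^-1 = (f g)^-1.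
Proof. by apply: (mulgI (f g)); rewrite -fM !mulgV f1. Qed.
Let hV g : h g^-1 = (h g)^-1.
Proof. by apply: (mulgI (h g)); rewrite -hM !mulgV h1. Qed.

Lemma weval_rel : nu_compatible f h ->
  forall u v, nu_rel u v -> weval f h u = weval f h v.
Proof.
move=> cfh u v; elim=> {u v}.
- by move=> g1 g2; rewrite /weval !big_cons !big_nil !mulg1 fM.
- by move=> g1 g2; rewrite /weval !big_cons !big_nil !mulg1 hM.
- by rewrite /weval !big_cons !big_nil !mulg1 f1.
- by rewrite /weval !big_cons !big_nil !mulg1 h1.
- move=> g1 g2 g3; rewrite /weval /wconj /wcomm /winv /rev /=.
  rewrite !big_cons !big_nil !mulg1 !(fV, hV).
  have [+ _] := cfh g1 g2 g3.
  by rewrite [_ ^ f g3]/conjg /commg ![_ ^ h _]/conjg -!mulgA.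
- move=> g1 g2 g3; rewrite /weval /wconj /wcomm /winv /rev /=.
  rewrite !big_cons !big_nil !mulg1 !(fV, hV).
  have [_ +] := cfh g1 g2 g3.
  by rewrite [_ ^ h g3]/conjg /commg ![_ ^ h _]/conjg -!mulgA.
- by [].
- by move=> u v _ ->.
- by move=> u v w _ -> _ ->.
- by move=> u u' v v' _ + _; rewrite /weval !big_cat /= => -> ->.
Qed.

Lemma nu_liftP : nu_compatible f h ->
  [/\ {morph nu_lift f h : a b / a * b},
      nu_lift f h \o @nu_l G =1 f & nu_lift f h \o @nu_r G =1 h].
Proof.
move=> cfh; have E u : nu_lift f h (\pi_(nu G) u) = weval f h u.
  by apply: weval_rel => //; apply: nu_reprP.
split=> [a b | g | g].
- have [u ->] := nu_pi_surj a; have [v ->] := nu_pi_surj b.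
  rewrite [_ * _]nu_mul_pi !E.
  by rewrite /weval big_cat.
- by rewrite /= E /weval big_seq1.
- by rewrite /= E /weval big_seq1.
Qed.

Lemma nu_lift_uniq (k : nu G -> H) :
    {morph k : a b / a * b} -> k \o @nu_l G =1 f -> k \o @nu_r G =1 h ->
  k =1 nu_lift f h.
Proof.
move=> kM kl kr a; rewrite -{1}[a]reprK /nu_lift.
elim: (repr a) => [|x w IHw].
  rewrite /weval big_nil; apply: (mulgI (k (\pi_(nu G) [::]))).
  by rewrite mulg1 -kM; congr (k _); apply: nu_mul_pi.
rewrite /weval big_cons -/(weval f h w) -IHw.
have -> : \pi_(nu G) (x :: w) = (\pi_(nu G) [:: x] : nu G) * \pi_(nu G) w.
  by apply/esym/nu_mul_pi.
by rewrite kM; case: x => g; congr (_ * _); [apply: kl | apply: kr].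
Qed.

End NuUniversal.

Lemma nu_l_r_compatible (G : groupType) : nu_compatible (@nu_l G) (@nu_r G).
Proof.
pose pi (u : seq (G + G)) : nu G := \pi_(nu G) u.
have M u v : pi u * pi v = pi (u ++ v) by apply: nu_mul_pi.
have V u : (pi u)^-1 = pi (winv u) by apply: nu_inv_pi.
have J u v : pi u ^ pi v = pi (wconj u v).
  by rewrite /conjg (V v) (M u v) (M (winv v)).
have C u v : [~ pi u, pi v] = pi (wcomm u v).
  by rewrite /commg (V u) (J u v) (M (winv u)).
move=> g1 g2 g3; rewrite -[@nu_l G]/(fun g => pi [:: inl g]).
rewrite -[@nu_r G]/(fun g => pi [:: inr g]) /=.
rewrite (C [:: inl g1] [:: inr g2]) (C [:: inl (g1 ^ g3)] [:: inr (g2 ^ g3)]).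
rewrite (J _ [:: inl g3]) (J _ [:: inr g3]).
by split; apply/nu_piP; [apply: NuConjL | apply: NuConjR].
Qed.

Section PowerfulPotent.
Variables (gT : finGroupType) (p : nat).

Definition agemo (m : nat) (H : {set gT}) : {set gT} :=
  <<[set x ^+ m | x in H]>>.

(* These are the definitions for odd p only: p = 2 needs a modified condition. *)
Definition powerful (H : {set gT}) : bool :=
  p.-group H && (H^`(1) \subset agemo p H).

Definition potent (H : {set gT}) : bool :=
  p.-group H && ('L_p.-1(H) \subset agemo p H).

End PowerfulPotent.

Definition isomorphic (A B : groupType) : Prop :=
  exists2 f : A -> B, {morph f : x y / x * y} & bijective f.

(* Main.v *)
(* Write t(a,b) for the commutator of a and b^phi. Conjugation by c and by
   c^phi agree on all t(a,b), and the commutator of t(a,b) with c^phi is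
   t([a,b],c).

   Finiteness: the t(a,b) form a finite normal subset of nu(G). They have
   finite order, by downward induction on the term of the lower central series
   that contains a, because t(a^n,b) is t(a,b)^n times a product of elements
   t(x,y) with x in the next term. By Dietzmann's lemma they generate a finite
   subgroup, and every element of nu(G) is g h^phi s with s in this subgroup.

   The key to the rest: in a quotient of nu(G) that kills [a,G] and [a,G]^phi,
   the element t(a,g) is central, so a and a^phi lie in the second center.
   Applied along the lower central series of G, this shows that nu(G) is
   nilpotent, hence a p-group. Modulo p-th powers G' dies, because G is
   powerful, so the quotient has class at most 2, and gamma_(p-1)(nu(G)) <=
   gamma_3(nu(G)) <= nu(G)^p. Finally let G_k be generated by the p^k-th powers
   of G; then [G_k,G] <= G_(k+1) and (G_k)^p <= G_(k+1). In a quotient of nu(G)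
   that kills G_(k+1), the images of G_k lie in Omega_1(Z_2), which has exponent
   p since Z_2 has class at most 2 and p is odd. So each step down the series
   costs a factor p in the exponent. *)
Require Import Defs.
From HB Require Import structures.
From mathcomp Require Import all_boot all_fingroup all_solvable.

Set Implicit Arguments.
Unset Strict Implicit.
Unset Printing Implicit Defensive.

Local Open Scope group_scope.

(** * Identities in groups satisfying the relations of nu(G) *)

Section GroupMorph.
Variables (G H : groupType) (f : G -> H).
Hypothesis fM : {morph f : x y / x * y}.

Lemma gmorph1 : f 1 = 1.
Proof. by apply: (mulgI (f 1)); rewrite -fM !mulg1. Qed.

Lemma gmorphV : {morph f : x / x^-1}.
Proof. by move=> x; apply: (mulgI (f x)); rewrite -fM !mulgV gmorph1. Qed.

Lemma gmorphJ : {morph f : x y / x ^ y}.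
Proof. by move=> x y; rewrite !conjgE !fM gmorphV. Qed.

Lemma gmorphR : {morph f : x y / [~ x, y]}.
Proof. by move=> x y; rewrite !commgEl fM gmorphV gmorphJ. Qed.

Lemma gmorphX n : {morph f : x / x ^+ n}.
Proof.
by move=> x; elim: n => [|n IHn]; rewrite ?expg0 ?gmorph1 // !expgS fM IHn.
Qed.

End GroupMorph.

Lemma commMJ (H : groupType) (x y z : H) :
  [~ x * y, z] = [~ x, z] ^ y * [~ y, z].
Proof.
by rewrite !commgEl !conjgE !invgM !mulgA !mulgK.
Qed.

Lemma nu_compatible_sym (G H : groupType) (f h : G -> H) :
  nu_compatible f h -> nu_compatible h f.
Proof.
move=> cfh g1 g2 g3; have [Ef Eh] := cfh g2 g1 g3.
by rewrite -invgR -[[~ h (g1 ^ g3), _]]invgR !conjVg Ef Eh.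
Qed.

Section Compatible.
Variables (G H : groupType) (f h : G -> H).
Hypotheses (fM : {morph f : x y / x * y}) (hM : {morph h : x y / x * y}).
Hypothesis cfh : nu_compatible f h.

Lemma tensorJl a b c : [~ f a, h b] ^ f c = [~ f (a ^ c), h (b ^ c)].
Proof. by have [-> _] := cfh a b c. Qed.

Lemma tensorJr a b c : [~ f a, h b] ^ h c = [~ f (a ^ c), h (b ^ c)].
Proof. by have [_ ->] := cfh a b c. Qed.

Lemma tensorV a b : [~ f a, h b]^-1 = [~ f a^-1, h (b ^ a)].
Proof.
apply: (mulIg [~ f a, h b]); rewrite mulVg.
have -> : [~ f a^-1, h (b ^ a)] = [~ f a^-1, h b] ^ f a.
  by rewrite tensorJl [a^-1 ^ a]conjgE mulVg mulg1.
by rewrite -commMJ -fM mulVg (gmorph1 fM) comm1g.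
Qed.

(** The conjugating commutator is a word in [f c] and [h d], and each letter, from either copy, acts
    on both arguments of a tensor [[~ f x, h y]] at once. *)
Lemma tensorJt a b c d :
  [~ f a, h b] ^ [~ f c, h d] = [~ f (a ^ [~ c, d]), h (b ^ [~ c, d])].
Proof.
have E (K : groupType) (x y : K) : [~ x, y] = x^-1 * y^-1 * x * y.
  by rewrite commgEl conjgE !mulgA.
rewrite (E _ (f c)) (E _ c) !conjgM -(gmorphV fM) -(gmorphV hM).
by rewrite !(tensorJl, tensorJr).
Qed.

(* [f [~ b, d]] and [[~ f b, h d]] need not be equal, but they differ by a right
   factor that centralizes the image of [h]. *)
Lemma tensor_factor_commute b d c :
  commute ([~ f b, h d]^-1 * f [~ b, d]) (h c).
Proof.
have K x : [~ f (x ^ d), h c] = [~ f x ^ h d, h c].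
  rewrite -{1}[c](conjgKV d) -tensorJr conjRg; congr [~ _, _].
  by rewrite -(gmorphJ hM) conjgKV.
(* Taking [b^-1] turns the equality of commutators into X (X^(h c))^-1 = Y (Y^(h c))^-1, so Y^-1 X
   is fixed by [h c]. *)
have:= K b^-1; rewrite conjVg !(gmorphV fM) conjVg !commgEl !invgK !conjVg.
set X := f (b ^ d); set Y := f b ^ h d => EXY.
have -> : [~ f b, h d]^-1 * f [~ b, d] = Y^-1 * X.
  rewrite (gmorphR fM) !commgEl invgM invgK -(gmorphJ fM) -/X -/Y.
  by rewrite -mulgA mulVKg.
apply/commgP/conjg_fixP; rewrite conjMg conjVg.
apply: (mulgI Y); rewrite mulgA -EXY -mulgA mulVg mulg1.
by rewrite mulgA mulgV mul1g.
Qed.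

(** Write [f [~ b, d]] as [[~ f b, h d] * w]. Then [w] centralizes [h c], and also every tensor,
    since [f [~ b, d]] and [[~ f b, h d]] conjugate tensors in the same way. Hence [w] cancels in
    the commutator with [h c]. *)
Lemma tensor_comm b d c : [~ f [~ b, d], h c] = [~ [~ f b, h d], h c].
Proof.
have wC := tensor_factor_commute b d c.
set w := _ * _ in wC; have -> : f [~ b, d] = [~ f b, h d] * w.
  by rewrite /w mulgA mulgV mul1g.
have wT x y : commute w [~ f x, h y].
  apply/commute_sym/commgP/conjg_fixP.
  rewrite -[x](conjgKV [~ b, d]) -[y](conjgKV [~ b, d]).
  by rewrite -tensorJt -conjgM /w mulgA mulgV mul1g tensorJl tensorJt.
have wJ : w ^ h c = w by apply/conjg_fixP/commgP.
have wR : commute w ([~ f b, h d]^-1 * [~ f b, h d] ^ h c).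
  by rewrite tensorJr; apply: commuteM; [apply: commuteV | ].
rewrite commgEl [RHS]commgEl conjMg wJ invgM -mulgA.
by rewrite (mulgA [~ f b, h d]^-1) -wR mulKg.
Qed.


End Compatible.

(** * Elements whose commutators are killed in both copies *)

Section Killed.
Variables (G H : groupType) (f h : G -> H).
Hypotheses (fM : {morph f : x y / x * y}) (hM : {morph h : x y / x * y}).
Hypothesis cfh : nu_compatible f h.
Variable a : G.
Hypotheses (fa : forall y, f [~ a, y] = 1) (ha : forall y, h [~ a, y] = 1).

Lemma killed_commute_l y : commute (f a) (f y).
Proof. by apply/commgP; rewrite -(gmorphR fM) fa. Qed.

(** Conjugation by [a] changes [g] and [x] only by commutators with [a], which both maps kill. *)
Lemma killed_commute_tensor g x : commute (f a) [~ f g, h x].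
Proof.
apply/commute_sym/commgP/conjg_fixP; rewrite (tensorJl cfh).
rewrite -(mulVKg g (g ^ a)) -(mulVKg x (x ^ a)) -!commgEl.
by rewrite -!(invgR a) fM hM (gmorphV fM) (gmorphV hM) fa ha invg1 !mulg1.
Qed.

Lemma killed_commute_comm g x : commute (f a) (h [~ g, x]).
Proof.
apply/commute_sym/commgP/eqP.
rewrite (tensor_comm hM fM (nu_compatible_sym cfh)) -(invgR (f x)).
by apply/eqP/commgP/commute_sym/commuteV/killed_commute_tensor.
Qed.

Lemma killed_tensor_commute g x :
  commute [~ f a, h g] (h x) /\ commute [~ f a, h g] (f x).
Proof.
suffices hx: [~ f a, h g] ^ h x = [~ f a, h g].
  by split; apply/commgP/conjg_fixP; rewrite // (tensorJl cfh) -(tensorJr cfh).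
set z := [~ f a, h g].
(* [z] is (f a)^-1 times (f a)^(h g). The first factor centralizes all tensors, and so does the
   second, because [h g] permutes them. *)
have zt : commute z [~ f g, h x].
  rewrite /z commgEl; apply/commute_sym/commuteM.
    by apply/commuteV/commute_sym/killed_commute_tensor.
  apply/commgP/eqP; rewrite -[[~ f g, h x]](conjgKV (h g)) -conjRg.
  rewrite -(gmorphV hM) (tensorJr cfh).
  apply/eqP; rewrite conjg_eq1.
  exact/commgP/commute_sym/killed_commute_tensor.
(* As [f [~ a, x]] is trivial, only [g] moves, to g [g, x]; since [f a] commutes with [h [~ g, x]],
   this amounts to a conjugation of [z]. On tensors it agrees with conjugation by [[~ f g, h x]],
   which fixes [z]. *)
have -> : z ^ h x = z ^ h [~ g, x].
  rewrite /z (tensorJr cfh) -(mulVKg a (a ^ x)) -(mulVKg g (g ^ x)) -!commgEl.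
  have /commgP/conjg_fixP := killed_commute_comm g x.
  rewrite fM fa mulg1 hM; move: (h [~ g, x]) => c ac.
  by rewrite [LHS]commgEl conjgM [in RHS]commgEl [RHS]conjMg conjVg ac.
rewrite (tensorJr cfh) -(tensorJt fM hM cfh).
exact/conjg_fixP/commgP.
Qed.

End Killed.

(** * Dietzmann's lemma and torsion of the tensors *)

Section Torsion.
Variable H : groupType.
Implicit Types (x y : H) (w T : seq H).

Definition torsion x := exists2 n, 0 < n & x ^+ n = 1.

Lemma torsionV x : torsion x -> torsion x^-1.
Proof. by case=> n n0 xn; exists n; rewrite // expVgn xn invg1. Qed.

Lemma torsion_expg x n : 0 < n -> torsion (x ^+ n) -> torsion x.
Proof.
by move=> n0 [m m0 xm]; exists (n * m)%N; rewrite ?muln_gt0 ?n0 // expgM.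
Qed.

Lemma torsion_finite_powers x (L : seq H) :
  (forall n, x ^+ n \in L) -> torsion x.
Proof.
move=> xL; pose s := [seq x ^+ i | i <- iota 0 (size L).+1].
have: ~~ uniq s.
  apply/negP=> /uniq_leq_size/(_ _)/=; move/(_ L) => sL.
  have: size s <= size L by apply: sL => _ /mapP[i _ ->].
  by rewrite size_map size_iota ltnn.
case/(uniqPn 1) => i [j [ltij]]; rewrite size_map size_iota => ltj.
rewrite !(nth_map 0%N) ?size_iota ?nth_iota ?(ltn_trans ltij) // !add0n => Eij.
exists (j - i)%N; first by rewrite subn_gt0.
by apply: (mulgI (x ^+ i)); rewrite -expgD subnKC ?mulg1 // ltnW.
Qed.

Lemma torsion_common_exponent T :
  {in T, forall x, torsion x} ->
  exists2 n, 0 < n & {in T, forall x, x ^+ n = 1}.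
Proof.
elim: T => [|x T IHT] torT; first by exists 1%N.
have [m m0 xm] := torT x (mem_head x T).
have [y yT|n n0 Tn] := IHT; first by apply: torT; rewrite inE yT orbT.
exists (m * n)%N => [|y]; first by rewrite muln_gt0 m0.
rewrite inE => /predU1P[->|yT]; first by rewrite expgM xm expg1n.
by rewrite mulnC expgM Tn ?expg1n.
Qed.

Lemma pigeonhole_count (I : eqType) (T w : seq I) n :
  {subset w <= T} -> size T * n < size w ->
  exists2 x, x \in T & n < count_mem x w.
Proof.
elim: T w => [|x T IHT] w wT.
  by case: w wT => // x w /(_ x (mem_head x w)).
rewrite mulSn; have [|le_xn ltw] := ltnP n (count_mem x w).
  by exists x; rewrite ?mem_head.
have /IHT IHw : {subset [seq y <- w | y != x] <= T}.
  by move=> y; rewrite mem_filter => /andP[yx /wT]; rewrite inE (negPf yx).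
have [|y yT lty] := IHw.
  rewrite size_filter -(ltn_add2l (count_mem x w)) count_predC.
  by apply: leq_ltn_trans ltw; rewrite leq_add2r.
exists y; first by rewrite inE yT orbT.
by apply: leq_trans lty _; rewrite count_filter sub_count // => z /andP[].
Qed.

Lemma finite_bounded_words T k :
  exists L : seq H, forall w, {subset w <= T} -> size w <= k ->
    \prod_(x <- w) x \in L.
Proof.
elim: k => [|k [L HL]].
  by exists [:: 1] => -[|x w] // _ _; rewrite big_nil mem_head.
exists (1 :: [seq x * y | x <- T, y <- L]) => -[|x w] wT.
  by rewrite big_nil mem_head.
move=> sw; rewrite big_cons inE; apply/orP; right.
apply: allpairs_f; first by rewrite wT ?mem_head.
by apply: HL sw => y yw; rewrite wT // inE yw orbT.
Qed.

Section Dietzmann.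
Variable T : seq H.
Hypothesis TJ : {in T &, forall x y, x ^ y \in T}.

Lemma prod_extract x k w :
  x \in T -> {subset w <= T} -> k <= count_mem x w ->
  exists w', [/\ {subset w' <= T}, size w = (k + size w')%N
               & \prod_(y <- w) y = x ^+ k * \prod_(y <- w') y].
Proof.
move=> xT; elim: w k => [|y w IHw] k wT.
  by rewrite leqn0 => /eqP->; exists [::]; split; rewrite ?big_nil ?mulg1.
have yT : y \in T by rewrite wT ?mem_head.
have wT' : {subset w <= T} by move=> z zw; rewrite wT // inE zw orbT.
rewrite /=; have [Eyx | yx] := eqVneq y x; last first.
  rewrite add0n => /(IHw _ wT')[w' [w'T sw pw]].
  exists (y ^ (x ^+ k) :: w'); split; last 1 first.
  - by rewrite !big_cons pw mulgA (conjgC y) -mulgA.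
  - move=> z; rewrite inE => /predU1P[->|/w'T//].
    elim: k {pw sw} => [|j IHj]; first by rewrite expg0 conjg1.
    by rewrite expgSr conjgM TJ.
  - by rewrite /= sw addnS.
case: k => [_|k]; first by exists (y :: w); split; rewrite // expg0 mul1g.
rewrite add1n ltnS => /(IHw _ wT')[w' [w'T sw pw]].
by exists w'; split; rewrite // ?sw // Eyx big_cons pw mulgA -expgS.
Qed.

(* A long word has a letter of multiplicity at least its order; these letters
   can be moved to the front by conjugating the others, where they cancel. *)
Lemma Dietzmann_finite :
  {in T, forall x, torsion x} ->
  exists L : seq H, forall w, {subset w <= T} -> \prod_(x <- w) x \in L.
Proof.
move=> /torsion_common_exponent[[//|n] _ Tn].
have [L HL] := finite_bounded_words T (size T * n).
exists L => w; have [m] := ubnP (size w); elim: m w => // m IHm w ltwm wT.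
have [|/(pigeonhole_count wT)[x xT ltx]] := leqP (size w) (size T * n).
  exact: HL.
have [w' [w'T sw ->]] := prod_extract xT wT ltx.
rewrite Tn // mul1g IHm //; rewrite ltnS in ltwm; apply: leq_trans ltwm.
by rewrite sw addSn ltnS leq_addl.
Qed.

Lemma Dietzmann_torsion w :
  {in T, forall x, torsion x} -> {subset w <= T} -> torsion (\prod_(x <- w) x).
Proof.
move=> /Dietzmann_finite[L HL] wT; apply: (@torsion_finite_powers _ L) => n.
suffices [w' w'T ->] : exists2 w', {subset w' <= T}
    & (\prod_(x <- w) x) ^+ n = \prod_(x <- w') x by apply: HL.
elim: n => [|n [w' w'T Ew]]; first by exists [::]; rewrite ?big_nil.
exists (w ++ w'); last by rewrite big_cat /= expgS Ew.
by move=> x; rewrite mem_cat => /orP[/wT|/w'T].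
Qed.

End Dietzmann.
End Torsion.

Section TensorTorsion.
Variables (G : finGroupType) (H : groupType) (f h : G -> H).
Hypotheses (fM : {morph f : x y / x * y}) (hM : {morph h : x y / x * y}).
Hypothesis cfh : nu_compatible f h.

Definition tensors (A : {set G}) : seq H :=
  [seq [~ f x, h y] | x <- enum A, y <- enum G].

Lemma mem_tensors (A : {set G}) x y : x \in A -> [~ f x, h y] \in tensors A.
Proof. by move=> xA; apply: allpairs_f; rewrite mem_enum. Qed.

Lemma tensorsJt (A : {group G}) x y t :
  [set: G] \subset 'N(A) -> t \in tensors A -> t ^ [~ f x, h y] \in tensors A.
Proof.
move=> nA /allpairsP[[a b] [/= + _ ->]]; rewrite mem_enum => aA.
by rewrite (tensorJt fM hM cfh) mem_tensors ?memJ_norm // (subsetP nA) ?inE.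
Qed.

Lemma tensor_torsion_step (A B : {group G}) :
    [set: G] \subset 'N(B) -> [~: A, [set: G]] \subset B ->
    {in B, forall a b, torsion [~ f a, h b]} ->
  {in A, forall a b, torsion [~ f a, h b]}.
Proof.
move=> nB sAB torB a aA b; set t := [~ f a, h b].
have TJ : {in tensors B &, forall x y, x ^ y \in tensors B}.
  move=> x y xT /allpairsP[[c d] [/= _ _ ->]]; exact: tensorsJt.
have torT : {in tensors B, forall x, torsion x}.
  move=> x /allpairsP[[c d] [/= + _ ->]]; rewrite mem_enum => cB; exact: torB.
have [w wT Ew] : exists2 w, {subset w <= tensors B}
    & [~ f (a ^+ #[a]), h b] = t ^+ #[a] * \prod_(x <- w) x.
  elim: #[a] => [|n [w wT Ew]].
    by exists [::]; rewrite // big_nil !expg0 (gmorph1 fM) comm1g mulg1.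
  pose u := [~ f [~ a, b], h (a ^+ n)].
  exists (u ^ (t ^+ n) :: w).
    move=> x; rewrite inE => /predU1P[->|/wT//].
    have uT : u \in tensors B.
      by rewrite mem_tensors // (subsetP sAB) // mem_commg ?inE.
    move: (u) uT => v vT.
    elim: n {w wT Ew u} v vT => [|n IHn] v vT; first by rewrite expg0 conjg1.
    by rewrite expgS conjgM IHn // tensorsJt.
  (* One more factor [a] contributes t^(f (a^n)) = t^(h (a^n)) = t u by [tensor_comm]; then [u] is
     moved right past [t ^+ n]. *)
  rewrite big_cons expgS fM commMJ (tensorJl cfh) -(tensorJr cfh) -/t Ew.
  rewrite -(mulVKg t (t ^ _)) -commgEl -(tensor_comm fM hM cfh) -/u.
  by rewrite expgS -!(mulgA t) (mulgA u) (conjgC u) -(mulgA (t ^+ n)).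
have /(torsion_expg (order_gt0 a)) // : torsion (t ^+ #[a]).
have -> : t ^+ #[a] = (\prod_(x <- w) x)^-1.
  apply: (mulIg (\prod_(x <- w) x)).
  by rewrite mulVg -Ew expg_order (gmorph1 fM) comm1g.
exact/torsionV/(Dietzmann_torsion TJ torT wT).
Qed.

Lemma tensor_torsion a b : nilpotent [set: G] -> torsion [~ f a, h b].
Proof.
case/lcnP=> n Ln.
(* ['L_n.+1] is trivial and ['L_1] is the whole group, so the index runs down from n + 1 to 1 as [k]
   grows. *)
suffices torL k : k <= n ->
    {in 'L_(n.+1 - k)([set: G]), forall a b, torsion [~ f a, h b]}.
  by apply: (torL n); rewrite // subSnn lcn1 inE.
elim: k => [_|k IHk ltkn].
  rewrite subn0 Ln => _ /set1P-> {}b.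
  by rewrite (gmorph1 fM) comm1g; exists 1%N; rewrite ?expg1n.
apply: tensor_torsion_step (IHk (ltnW ltkn)); first exact: lcn_norm.
by rewrite subSS subSn 1?ltnW // -(subnSK ltkn) /= lcnSn.
Qed.

End TensorTorsion.

(** * Finiteness of nu(G) *)

(** The carrier and the law stay the same; [L] only supplies the countable and finite structures, so
    the isomorphism is the identity. *)
Lemma enumerated_group_isomorphic (H : groupType) (L : seq H) :
  (forall z, z \in L) -> exists N : finGroupType, isomorphic N H.
Proof.
move=> HL.
have pickleK : pcancel (index^~ L) (fun n => ohead (drop n L)).
  by move=> z; rewrite (drop_nth z) ?index_mem //= nth_index.
have enumP : Finite.axiom (undup L).
  by move=> z; rewrite count_uniq_mem ?undup_uniq // mem_undup HL.
pose N : finGroupType := HB.pack (Group.sort H)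
  (Choice_isCountable.Build H pickleK) (isFinite.Build H enumP).
by exists N; exists id => //; exists id.
Qed.

Section NuFinite.
Variable G : finGroupType.
Local Notation f := (@nu_l G).
Local Notation h := (@nu_r G).

Lemma nu_ind (P : nu G -> Prop) :
    P 1 -> (forall g z, P z -> P (nu_l g * z)) ->
    (forall g z, P z -> P (nu_r g * z)) ->
  forall z, P z.
Proof.
move=> P1 Pl Pr z; have [u ->] := nu_pi_surj z.
elim: u => [//|[g|g] u IHu]; rewrite -cat1s -nu_mul_pi.
  exact: (Pl g _ IHu).
exact: (Pr g _ IHu).
Qed.

Lemma nu_finite :
  nilpotent [set: G] -> exists L : seq (nu G), forall z, z \in L.
Proof.
move=> nilG; pose T := tensors f h [set: G].
have TJ : {in T &, forall x y, x ^ y \in T}.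
  move=> x y xT /allpairsP[[c d] [/= _ _ ->]].
  apply: (tensorsJt (@nu_lM G) (@nu_rM G) (@nu_l_r_compatible G)) xT.
  exact: normG [set: G]%G.
have torT : {in T, forall x, torsion x}.
  move=> _ /allpairsP[[c d] [/= _ _ ->]].
  exact: (tensor_torsion (@nu_lM G) (@nu_rM G) (@nu_l_r_compatible G)).
have [L HL] := Dietzmann_finite TJ torT.
exists [seq x * y | x <- [seq f a * h b | a <- enum G, b <- enum G], y <- L].
move=> z.
suffices [a [b [w wT ->]]] : exists a b, exists2 w, {subset w <= T}
    & z = f a * h b * \prod_(x <- w) x.
  by apply: allpairs_f; [apply: allpairs_f; rewrite mem_enum | apply: HL].
elim/nu_ind: z => [|g _ [a [b [w wT ->]]]|g _ [a [b [w wT ->]]]].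
- exists 1, 1, [::] => //.
  by rewrite big_nil (gmorph1 (@nu_lM G)) (gmorph1 (@nu_rM G)) !mulg1.
- by exists (g * a), b, w; rewrite // nu_lM !mulgA.
(* Moving [h g] right past [f a] creates [[~ h g, f a]], and moving this past [h b] conjugates it.
   By [tensorV] the inverse of a tensor is a tensor, which gives the new letter. *)
exists a, (g * b), ([~ f (a^-1 ^ b), h ((g ^ a) ^ b)] :: w).
  move=> x; rewrite inE => /predU1P[->|/wT//].
  by apply: mem_tensors; rewrite inE.
rewrite big_cons; set t := [~ _, _].
have : [~ nu_r g, f a] * h b = h b * t.
  rewrite conjgC /t -(tensorJr (@nu_l_r_compatible G)).
  by rewrite -(tensorV (@nu_lM G) (@nu_l_r_compatible G)) invgR.
move: t => t Et; rewrite nu_rM !mulgA; congr (_ * _).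
by rewrite -[RHS]mulgA -Et [RHS]mulgA -commgC.
Qed.

End NuFinite.

(** * Power series of a powerful p-group *)

Section PowerSeries.
Variables (gT : finGroupType) (p : nat).
Implicit Types (G K J M : {group gT}) (A : {set gT}).

(** Modulo [M] the group [<<A>>] is abelian, so its exponent can be read off the generators. *)
Lemma expg_gen_mod M A n : A \subset 'N(M) -> [~: <<A>>, <<A>>] \subset M ->
  {in A, forall x, x ^+ n \in M} -> {in <<A>>, forall x, x ^+ n \in M}.
Proof.
move=> nMA sAAM An x Ax.
have nMgA : <<A>> \subset 'N(M) by rewrite gen_subG.
have cA : abelian (A / M).
  have: abelian (<<A>> / M) by apply: quotient_cents2r.
  by rewrite quotient_gen // abelian_gen.
apply: coset_idr; first by rewrite groupX // (subsetP nMgA).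
rewrite morphX ?(subsetP nMgA) //.
have: exponent <<A / M>> %| n.
  rewrite abelian_exponent_gen //; apply/exponentP => _ /morphimP[y Ny Ay ->].
  have <- : coset M (y ^+ n) = coset M y ^+ n by rewrite morphX.
  by rewrite coset_id // An.
move/exponentP; apply; rewrite -quotient_gen //; exact: mem_quotient.
Qed.

(** [J] and [K] stand for images of consecutive terms of the power series. For u in [K], centrality
    gives [u, z]^p = [u^p, z] = [u, z^p], so [A] is abelian and [K] has exponent dividing p. For a =
    z^p in [A], a^g = (z [z, g])^p = z^p [z, g]^p [[z, g], z]^C(p, 2), and the last two factors
    vanish because p divides C(p, 2). *)
Lemma p_power_central_step G K J A :
    prime p -> odd p ->
    K :=: <<A>> -> J \subset G ->
    [~: J, G] \subset K -> [~: K, G] \subset 'C(G) ->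
    {in A, forall a, a ^+ p = 1} ->
    {in A, forall a, exists2 z, z \in J & a = z ^+ p} ->
  [~: K, G] = 1.
Proof.
move=> p_pr p_odd defK sJG sJGK cKG Ap AJ.
have AK a : a \in A -> a \in K by rewrite defK; apply: mem_gen.
have comm_central u z g : u \in K -> z \in G -> g \in G -> commute g [~ u, z].
  move=> Ku Gz Gg; apply/commute_sym.
  have: [~ u, z] \in 'C(G) by rewrite (subsetP cKG) // mem_commg.
  by move/centP; apply.
have sKG : K \subset G.
  rewrite defK gen_subG; apply/subsetP=> a /AJ[z Jz ->].
  by rewrite groupX // (subsetP sJG).
have Rp u z : u \in K -> z \in G -> [~ u, z] ^+ p = [~ u ^+ p, z].
  move=> Ku Gz; rewrite commXg //.
  exact: (comm_central u z u Ku Gz (subsetP sKG u Ku)).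
have cA : abelian A.
  apply/centsP=> u Au a /AJ[z Jz ->].
  have Gz := subsetP sJG z Jz.
  apply/commgP.
  rewrite commgX; last exact: (comm_central u z z (AK u Au) Gz Gz).
  by rewrite Rp ?AK // Ap // comm1g.
have Kp c : c \in K -> c ^+ p = 1.
  rewrite defK; move: c; apply/exponentP; rewrite abelian_exponent_gen //.
  exact/exponentP.
apply/commG1P; rewrite defK gen_subG; apply/subsetP=> a Aa.
apply/centP=> g Gg; apply/commgP/conjg_fixP.
have [z Jz ->] := AJ a Aa; have Gz := subsetP sJG z Jz.
have Kc : [~ z, g] \in K by rewrite (subsetP sJGK) ?mem_commg.
rewrite conjXg conjg_mulR expMg_Rmul; last 2 first.
- exact: (comm_central _ z _ Kc Gz (subsetP sKG _ Kc)).
- exact: comm_central.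
rewrite (Kp _ Kc) mulg1; have /dvdnP[m ->] : p %| 'C(p, 2).
  by rewrite prime_dvd_bin //=; case: p p_pr p_odd => [|[|[|]]].
by rewrite mulnC expgM Rp // Kp // comm1g expg1n mulg1.
Qed.

End PowerSeries.

Lemma Mho_powerful (gT : finGroupType) (p : nat) (G : {group gT}) :
  prime p -> odd p -> p.-group G -> G^`(1) \subset 'Mho^1(G) ->
  forall k, [~: 'Mho^k(G), G] \subset 'Mho^k.+1(G)
    /\ {in 'Mho^k(G), forall x, x ^+ p \in 'Mho^k.+1(G)}.
Proof.
move=> p_pr p_odd pG sG'; pose S k := [set x ^+ (p ^ k) | x in G].
have MhoS k : 'Mho^k(G) = <<S k>> by rewrite (MhoE _ pG).
have nM k : G \subset 'N('Mho^k(G)) by apply: gFnorm.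
have memMho k x : x \in G -> x ^+ (p ^ k) \in 'Mho^k(G).
  by move=> Gx; rewrite MhoS mem_gen //; apply: imset_f.
have Sp k a : a \in S k -> a ^+ p \in 'Mho^k.+1(G).
  by case/imsetP=> x Gx ->; rewrite -expgM -expnSr memMho.
have MhoX k : [~: 'Mho^k(G), G] \subset 'Mho^k.+1(G) ->
    {in 'Mho^k(G), forall x, x ^+ p \in 'Mho^k.+1(G)}.
  move=> sK; rewrite {1}MhoS; apply: expg_gen_mod; last exact: Sp.
    rewrite (subset_trans _ (nM _)) //; apply/subsetP=> _ /imsetP[x Gx ->].
    exact: groupX.
  by rewrite -MhoS (subset_trans _ sK) // commgS // Mho_sub.
suffices sMho k : [~: 'Mho^k(G), G] \subset 'Mho^k.+1(G).
  by move=> k; split; auto.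
elim: k => [|k IHk]; first by rewrite Mho0.
set K := 'Mho^k.+1(G)%G; set M := 'Mho^k.+2(G)%G.
have nKG := nM k.+1; have nMG := nM k.+2.
(* [K, G] lies in M[K, G, G], hence in M because G / M is nilpotent. *)
pose D := (M <*> [~: [~: K, G], G])%G.
have sKG : K \subset G by apply: Mho_sub.
have nDG : G \subset 'N(D) by rewrite normsY // normsR // normsR.
have sKD : [~: K, G] \subset D.
  have nDK := subset_trans sKG nDG.
  have sSG : S k.+1 \subset G.
    by apply/subsetP=> _ /imsetP[x Gx ->]; apply: groupX.
  rewrite -quotient_sub1 ?(subset_trans _ nDG) ?comm_subG // quotientR //.
  have nDM a : a \in M -> coset D a = 1.
    by move=> Ma; rewrite coset_id // mem_gen // inE Ma.
  have cosetX a n : a \in G -> coset D (a ^+ n) = coset D a ^+ n.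
    by move=> Ga; rewrite morphX ?(subsetP nDG).
  rewrite (@p_power_central_step _ p _ _ ('Mho^k(G) / D) (S k.+1 / D)) //.
  - by rewrite -quotient_gen ?(subset_trans sSG nDG) //= -MhoS.
  - by rewrite quotientS ?Mho_sub.
  - by rewrite -quotientR ?quotientS // (subset_trans (Mho_sub _ _)).
  - rewrite -quotientR // quotient_cents2r //; exact: joing_subr.
  - move=> _ /morphimP[a Na Sa ->].
    by rewrite -cosetX ?(subsetP sSG) // nDM // Sp.
  move=> _ /morphimP[_ _ /imsetP[x Gx ->] ->]; have Gxk := groupX (p ^ k) Gx.
  exists (coset D (x ^+ (p ^ k))).
    by rewrite mem_quotient // memMho.
  by rewrite -cosetX // -expgM -expnSr.
apply/idPn; rewrite -quotient_sub1 ?(subset_trans _ nMG) ?comm_subG // subG1.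
move=> ntR.
have nil_GM : nilpotent (G / M).
  by rewrite (pgroup_nil (p := p)) // quotient_pgroup.
have nMR : [~: [~: K, G], G] \subset 'N(M).
  by rewrite (subset_trans _ nMG) ?comm_subG.
have: [~: [~: K, G] / M, G / M] \proper [~: K, G] / M.
  apply: nil_comm_properl nil_GM _ ntR _; first by rewrite quotientS ?comm_subG.
  by rewrite subsetI subxx quotient_norms // normsR.
rewrite -quotientR ?(subset_trans _ nMG) ?comm_subG //.
move/proper_subn/negP; apply.
by rewrite -(quotientYidl nMR) quotientS.
Qed.

(** * Finite quotients of nu(G) *)

(* By the universal property, such a pair is a surjection from nu(G) to [N]. *)
Definition nu_pair (G : groupType) (N : finGroupType) (f h : G -> N) :=
  [/\ {morph f : x y / x * y}, {morph h : x y / x * y}, nu_compatible f h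
    & forall K : {group N}, (forall g, f g \in K) -> (forall g, h g \in K) ->
        [set: N] \subset K].

Lemma nu_pair_sym (G : groupType) (N : finGroupType) (f h : G -> N) :
  nu_pair f h -> nu_pair h f.
Proof.
by case=> fM hM /nu_compatible_sym cfh gen; split=> // K ? ?; apply: gen.
Qed.

Lemma nu_pair_quotient (G : groupType) (N : finGroupType) (f h : G -> N)
    (M : {group N}) :
  [set: N] \subset 'N(M) -> nu_pair f h ->
  nu_pair (coset M \o f) (coset M \o h).
Proof.
move=> nM [fM hM cfh gen].
have nMx x : x \in 'N(M) by rewrite (subsetP nM) ?inE.
have cM : {morph coset M : x y / x * y} by move=> x y; rewrite morphM.
split=> [x y|x y|g1 g2 g3|K fK hK] /=.
- by rewrite fM cM.
- by rewrite hM cM.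
- have [Ef Eh] := cfh g1 g2 g3.
  by rewrite -!(gmorphR cM) -!(gmorphJ cM) Ef Eh.
apply/subsetP=> X _; have [x _ ->] := cosetP X.
have: [set: N] \subset coset M @*^-1 K.
  by apply: gen => g; rewrite mem_morphpre //; [apply: fK | apply: hK].
by move/subsetP/(_ x (in_setT x))/morphpreP=> [[]].
Qed.

(** Modulo the center, [f a] commutes with both copies: with [f g] because [a, g] is killed, and
    with [h g] because [[~ f a, h g]] commutes with all generators. *)
Lemma nu_pair_ucn2_l (G : groupType) (N : finGroupType) (f h : G -> N) a :
    nu_pair f h -> (forall y, f [~ a, y] = 1) -> (forall y, h [~ a, y] = 1) ->
  f a \in 'Z_2([set: N]).
Proof.
move=> [fM hM cfh gen] fa ha; set Z := 'Z_1([set: N])%G.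
have nZ x : x \in 'N(Z) by rewrite (subsetP (ucn_norm 1 _)) ?inE.
suffices sNC : [set: N] \subset coset Z @*^-1 'C[coset Z (f a)].
  rewrite ucnSn -/Z mem_morphpre // inE mem_quotient ?inE //=.
  apply/centP=> _ /morphimP[x Nx _ ->].
  by have /morphpreP[_ /cent1P] := subsetP sNC x (in_setT x).
apply: (gen _) => g; rewrite mem_morphpre //; apply/cent1P.
  rewrite /commute -!morphM //; congr (coset Z _).
  exact: commute_sym (killed_commute_l fM fa g).
apply/commute_sym/commgP.
have <- : coset Z [~ f a, h g] = [~ coset Z (f a), coset Z (h g)].
  by rewrite morphR.
rewrite coset_id //= ucn1.
apply/centerP; split=> [|x _]; first by rewrite inE.
have: [set: N] \subset 'C[[~ f a, h g]].
  by apply: gen => y; apply/cent1P;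
    have [] := killed_tensor_commute fM hM cfh fa ha g y.
by move/subsetP/(_ x (in_setT x))/cent1P.
Qed.

Lemma nu_pair_ucn2 (G : groupType) (N : finGroupType) (f h : G -> N) a :
    nu_pair f h -> (forall y, f [~ a, y] = 1) -> (forall y, h [~ a, y] = 1) ->
  f a \in 'Z_2([set: N]) /\ h a \in 'Z_2([set: N]).
Proof.
move=> fh fa ha; split; first exact: nu_pair_ucn2_l fh fa ha.
exact: nu_pair_ucn2_l (nu_pair_sym fh) ha fa.
Qed.

Lemma quotientTT (N : finGroupType) (M : {group N}) :
  [set: N] \subset 'N(M) -> [set: N] / M = [set: coset_of M].
Proof.
move=> nM; apply/setP=> X; rewrite inE; have [x Nx ->] := cosetP X.
by rewrite mem_quotient ?inE.
Qed.

Lemma nilpotent_quotient_ucn (gT : finGroupType) (G : {group gT}) n :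
  nilpotent (G / 'Z_n(G)) -> nilpotent G.
Proof.
case/lcnP=> m Lm; have nZ := ucn_norm n G.
have: 'L_m.+1(G) \subset 'Z_n(G).
  rewrite -quotient_sub1 ?(subset_trans (lcn_sub _ _)) //.
  by rewrite /quotient morphim_lcn // Lm.
elim: n m {Lm nZ} => [|n IHn] m sLZ; apply/lcnP.
  by exists m; apply/trivgP; rewrite -(ucn0 G).
apply/lcnP/(IHn m.+1).
by rewrite lcnSn (subset_trans _ (ucn_comm n G)) // commSg.
Qed.

Lemma nu_pair_nilpotent (G N : finGroupType) (f h : G -> N) :
  nilpotent [set: G] -> nu_pair f h -> nilpotent [set: N].
Proof.
case/lcnP=> n Ln.
(* The target group must vary: if the term after ['L_k.+1] is killed, then ['L_k.+1] lands in ['Z_2]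
   and dies in the quotient by it. *)
move=> fh; suffices nilN k : forall (M : finGroupType) (u v : G -> M),
    {in 'L_k.+1([set: G]), forall a, u a = 1 /\ v a = 1} -> nu_pair u v ->
    nilpotent [set: M].
  apply: (nilN n _ _ _ _ fh) => a; rewrite Ln => /set1P->.
  by case: fh => fM hM _ _; rewrite (gmorph1 fM) (gmorph1 hM).
elim: k => [|k IHk] M u v uv1 uv.
  have [_ _ _ /(_ 1%G) gen] := uv.
  apply: nilpotentS (nilpotent1 _); apply: gen => g;
    by have [|ug vg] := uv1 g; rewrite ?lcn1 ?inE ?ug ?vg.
have uvZ a : a \in 'L_k.+1([set: G]) ->
    u a \in 'Z_2([set: M]) /\ v a \in 'Z_2([set: M]).
  move=> La; have LR y : [~ a, y] \in 'L_k.+2([set: G]).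
    by rewrite lcnSn mem_commg ?inE.
  exact: (nu_pair_ucn2 uv (fun y => proj1 (uv1 _ (LR y)))
    (fun y => proj2 (uv1 _ (LR y)))).
apply: (@nilpotent_quotient_ucn _ _ 2); rewrite quotientTT ?ucn_norm //.
apply: IHk (nu_pair_quotient (ucn_norm 2 _) uv) => a /uvZ[ua va].
by rewrite /= !coset_id.
Qed.

(** In a nilpotent group all p-elements lie in the p-core, which therefore contains the generators
    [f g] and [h g]. *)
Lemma nu_pair_pgroup (p : nat) (G N : finGroupType) (f h : G -> N) :
  p.-group [set: G] -> nu_pair f h -> p.-group [set: N].
Proof.
move=> pG fh; have nilN := nu_pair_nilpotent (pgroup_nil pG) fh.
have hallO := nilpotent_pcore_Hall p nilN.
case: fh => fM hM _ gen.
have pE (u : G -> N) g : {morph u : x y / x * y} -> u g \in 'O_p([set: N]).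
  move=> uM; rewrite (mem_Hall_pcore hallO) ?inE // /p_elt.
  apply: pnat_dvd (mem_p_elt pG (in_setT g)).
  by rewrite order_dvdn -(gmorphX uM) expg_order (gmorph1 uM).
by apply: pgroupS (pcore_pgroup p [set: N]); apply: gen => g; apply: pE.
Qed.

Lemma nu_pair_exponent (p : nat) (G N : finGroupType) (f h : G -> N)
    (P : nat -> {group G}) k :
    odd p -> p.-group [set: G] -> P 0 = [set: G] :> {set G} ->
    (forall i, [~: P i, [set: G]] \subset P i.+1) ->
    (forall i, {in P i, forall x, x ^+ p \in P i.+1}) ->
    nu_pair f h -> {in P k, forall a, f a = 1 /\ h a = 1} ->
  forall x : N, x ^+ (p ^ k) = 1.
Proof.
move=> p_odd pG P0 PR PX.
elim: k N f h => [|k IHk] N f h fh fh1 x.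
  have [_ _ _ /(_ 1%G) gen] := fh.
  have sN1 : [set: N] \subset [1].
    by apply: gen => g; have [|fg hg] := fh1 g; rewrite ?P0 ?inE ?fg ?hg.
  by have /set1P-> := subsetP sN1 x (in_setT x); rewrite expg1n.
have [fM hM _ _] := fh; have pN := nu_pair_pgroup pG fh.
set M := 'Ohm_1('Z_2([set: N]))%G.
have nM : [set: N] \subset 'N(M).
  by rewrite char_norm // (char_trans (Ohm_char _ _)) // ucn_char.
have pZ : p.-group 'Z_2([set: N]) by apply: pgroupS pN; apply: ucn_sub.
have expM : exponent M %| p.
  by rewrite exponent_Ohm1_class2 // nil_class_ucn.
have memM (u : G -> N) a : {morph u : x y / x * y} -> u (a ^+ p) = 1 ->
    u a \in 'Z_2([set: N]) -> u a \in M.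
  move=> uM uap Zua; rewrite /= (OhmE 1 pZ) mem_gen //; apply/LdivP.
  by rewrite expn1 -(gmorphX uM) uap.
(* The quotient by [M] kills [P k], so the induction hypothesis applies there; one more p-th power
   then kills [M]. *)
have: x ^+ (p ^ k) \in M.
  apply: coset_idr; first by rewrite (subsetP nM) ?inE.
  rewrite morphX ?(subsetP nM) ?inE //.
  apply: IHk (nu_pair_quotient nM fh) _ _ => a Pa.
  have Ry y : [~ a, y] \in P k.+1 by rewrite (subsetP (PR k)) // mem_commg ?inE.
  have [fZ hZ] := nu_pair_ucn2 fh (fun y => proj1 (fh1 _ (Ry y)))
    (fun y => proj2 (fh1 _ (Ry y))).
  by have [fap hap] := fh1 _ (PX _ _ Pa); rewrite /= !coset_id ?memM.
by move/(exponentP expM); rewrite -expgM -expnSr.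
Qed.

Lemma nu_pair_lcn3 (p : nat) (G N : finGroupType) (f h : G -> N) :
    powerful p [set: G] -> nu_pair f h ->
  'L_3([set: N]) \subset agemo p [set: N].
Proof.
move=> /andP[pG sG'] fh; set M := <<[set x ^+ p | x in [set: N]]>>%G.
have nM : [set: N] \subset 'N(M).
  apply: norms_gen; apply/subsetP=> x _; rewrite inE.
  apply/subsetP=> _ /imsetP[_ /imsetP[y _ ->] ->].
  by rewrite conjXg; apply: imset_f.
have kill (u : G -> N) : {morph u : x y / x * y} ->
    forall a y, coset M (u [~ a, y]) = 1.
  move=> uM a y; rewrite coset_id //.
  have: [~ a, y] \in agemo p [set: G].
    by rewrite (subsetP sG') // mem_commg ?inE.
  (* The preimage of [M] under [u] is a subgroup containing all p-th powers, hence [agemo p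
     [set: G]]. *)
  have uG : group_set (u @^-1: M).
    apply/group_setP; split=> [|x z]; rewrite !inE ?(gmorph1 uM) //.
    by rewrite uM; apply: groupM.
  suffices /subsetP sGM: agemo p [set: G] \subset Group uG.
    by move=> /sGM; rewrite inE.
  rewrite gen_subG; apply/subsetP=> _ /imsetP[x _ ->].
  by rewrite inE (gmorphX uM) mem_gen //; apply: imset_f.
have [fM hM _ _] := fh.
have ZT : 'Z_2([set: coset_of M]) = [set: coset_of M].
  apply/eqP; rewrite eqEsubset subsetT /=.
  have [_ _ _ gen] := nu_pair_quotient nM fh.
  have qfh := nu_pair_quotient nM fh.
  by apply: gen => a; have [] := nu_pair_ucn2 qfh (kill f fM a) (kill h hM a).
rewrite -quotient_sub1 ?(subset_trans _ nM) ?subsetT //.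
rewrite /quotient morphim_lcn // -/(quotient _ _) quotientTT //.
by rewrite (eqP (_ : 'L_3(_) == 1)) // ucn_lcnP ZT.
Qed.

(** The identity on both copies is compatible, so it lifts to a retraction of [nu G] onto [G]. *)
Lemma nu_l_inj (G : groupType) : injective (@nu_l G).
Proof.
have idM : {morph @id G : x y / x * y} by [].
have cid : nu_compatible (@id G) id by move=> g1 g2 g3; rewrite conjRg.
have [_ nuK _] := nu_liftP idM idM cid.
by move=> x y Exy; rewrite -[x]nuK -[y]nuK /= Exy.
Qed.

Lemma nu_pair_of_isomorphism (G N : finGroupType) (k : nu G -> N) :
  {morph k : x y / x * y} -> bijective k ->
  nu_pair (k \o @nu_l G) (k \o @nu_r G).
Proof.
move=> kM [k' kK k'K]; split=> [x y|x y|g1 g2 g3|K lK rK].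
- by rewrite /= nu_lM kM.
- by rewrite /= nu_rM kM.
- have [El Er] := nu_l_r_compatible g1 g2 g3.
  by rewrite /= -!(gmorphR kM) -!(gmorphJ kM) El Er.
apply/subsetP=> x _; rewrite -(k'K x); elim/nu_ind: (k' x) => [|g z Kz|g z Kz].
- by rewrite (gmorph1 kM).
- by rewrite kM groupM //; apply: lK.
by rewrite kM groupM //; apply: rK.
Qed.

Theorem corollary1p1 (p : nat) (G : finGroupType) :
  prime p -> (5 <= p)%N -> powerful p [set: G] ->
  exists N : finGroupType,
    [/\ isomorphic N (nu G),
        potent p [set: N]
      & exponent [set: N] = exponent [set: G]].
Proof.
move=> p_pr p_ge5 powG; have /andP[pG sG'] := powG.
have p_odd : odd p by case: (even_prime p_pr) p_ge5 => // ->.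
have [L HL] := nu_finite (pgroup_nil pG).
have [N isoN] := enumerated_group_isomorphic HL; exists N.
have [k' k'M [k k'K kK]] := isoN.
have kM : {morph k : x y / x * y}.
  by move=> x y; apply: (can_inj k'K); rewrite k'M !kK.
have fh := nu_pair_of_isomorphism kM (Bijective kK k'K).
split=> //.
  rewrite /potent (nu_pair_pgroup pG fh).
  rewrite (subset_trans _ (nu_pair_lcn3 powG fh)) //.
  (* Since p >= 5, ['L_p.-1] is contained in ['L_3]. *)
  by apply: lcn_sub_leq; rewrite -ltnS prednK ?prime_gt0 // ltnW.
(* The exponent of [G] divides that of [N] because [G] embeds; the converse uses the ['Mho] series,
   which is trivial at step [e] as p^e is the exponent of [G]. *)
apply/eqP; rewrite eqn_dvd; apply/andP; split; last first.
  apply/exponentP=> x _; apply: nu_l_inj; apply: (can_inj kK).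
  have [fM _ _ _] := fh.
  have := gmorphX fM (exponent [set: N]) x; rewrite /= => ->.
  by rewrite expg_exponent ?inE // (gmorph1 (@nu_lM G)) (gmorph1 kM).
have /p_natP[e Ee] : p.-nat (exponent [set: G]) by rewrite pnat_exponent.
rewrite Ee; apply/exponentP=> x _.
have sG1 : [set: G]^`(1) \subset 'Mho^1([set: G]).
  by rewrite (MhoE _ pG) expn1.
have MhoRX := Mho_powerful p_pr p_odd pG sG1.
pose P i := 'Mho^i([set: G])%G.
apply: (nu_pair_exponent (P := P) p_odd pG _ _ _ fh) => //=.
- by rewrite Mho0.
- by move=> i; have [] := MhoRX i.
- by move=> i; have [] := MhoRX i.
suffices Mho1 : 'Mho^e([set: G]) = 1.
  have [fM hM _ _] := fh.
  move=> a; rewrite Mho1 => /set1P->.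
  by split; [apply: (gmorph1 fM) | apply: (gmorph1 hM)].
rewrite (MhoE e pG); apply/trivgP; rewrite gen_subG.
apply/subsetP=> _ /imsetP[y _ ->].
by rewrite -Ee expg_exponent ?inE.
Qed.
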